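(* For any integers $d\ge2$ and $q\ge2$ and any positive real numbers $s,\tau$, $$ds^{d+q}-(d+q)s^d\tau^q+q\tau^{d+q}=q\sum_{k=1}^{d}k\,s^{k-1}\tau^{d+q-1-k}(s-\tau)^2+d(s-\tau)^2\sum_{j=0}^{q-2}(q-1-j)s^{d+j}\tau^{q-2-j}.$$ *)

(* Defs.v *)
From mathcomp Require Import all_boot all_order all_algebra.
From mathcomp Require Import reals.

(* Main.v *)
Require Import Defs.
From mathcomp Require Import all_boot all_order all_algebra.
From mathcomp Require Import reals.
From mathcomp Require Import ring zify.
Import Order.TTheory GRing.Theory Num.Theory.
Local Open Scope ring_scope.

(** The left-hand side is the weighted arithmetic-geometric gap between
    [s ^ (d + q)] and [tau ^ (d + q)], which vanishes to second order at
    [s = tau]; the right-hand side exhibits the resulting factor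
    [(s - tau) ^ 2].  Everything rests on the homogeneous tangent-line identity
      [(x - y) ^ 2 * \sum_(1 <= k <= n) k x ^ (k - 1) y ^ (n - k)
         = n x ^ (n + 1) - (n + 1) x ^ n y + y ^ (n + 1)],
    proved in [sum_tangent_gap] over any commutative ring.

    The first sum of the theorem is [tau ^ (q - 1)] times the left-hand side
    of this identity for [n = d] and [(x, y) = (s, tau)].  The second, once
    multiplied by [(s - tau) ^ 2] and read backwards, is [s ^ d] times it for
    [n = q - 1] and [(x, y) = (tau, s)].  After weighting by [q] and [d], the
    two terms in [s ^ (d + 1) tau ^ (q - 1)] cancel, and the coefficient
    of [s ^ d tau ^ q] is [- q (d + 1) + d (q - 1) = - (d + q)]. *)

(** Raising [n] multiplies the sum by [y] and adds one top term in [x ^ n],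
    so the identity follows by induction on [n]. *)
Lemma sum_tangent_gap (R : comNzRingType) (x y : R) (n : nat) :
  (x - y) ^+ 2 * \sum_(i < n) i.+1%:R * x ^+ i * y ^+ (n - i.+1) =
  n%:R * x ^+ n.+1 - n.+1%:R * x ^+ n * y + y ^+ n.+1.
Proof.
elim: n => [|n IHn]; first by rewrite big_ord0; ring.
rewrite big_ord_recr /= subnn.
have -> : \sum_(i < n) i.+1%:R * x ^+ i * y ^+ (n.+1 - i.+1) =
          y * \sum_(i < n) i.+1%:R * x ^+ i * y ^+ (n - i.+1).
  rewrite mulr_sumr; apply: eq_bigr => i _.
  by rewrite subSn // exprS; ring.
rewrite mulrDr mulrCA IHn !exprS -!natr1; ring.
Qed.

Theorem lemma3p3 (R : realType) (d q : nat) (hd : (2 <= d)%N) (hq : (2 <= q)%N)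
    (s tau : R) (hs : 0 < s) (htau : 0 < tau) :
  d%:R * s ^+ (d + q) - (d + q)%:R * s ^+ d * tau ^+ q + q%:R * tau ^+ (d + q) =
  q%:R * (\sum_(1 <= k < d.+1)
            k%:R * s ^+ (k - 1) * tau ^+ (d + q - 1 - k) * (s - tau) ^+ 2)
  + d%:R * (s - tau) ^+ 2 *
      (\sum_(0 <= j < q - 1)
         (q - 1 - j)%:R * s ^+ (d + j) * tau ^+ (q - 2 - j)).
Proof.
case: q hq => // n _; have -> : (n.+1 - 1 = n)%N by rewrite subn1.
have -> : \sum_(1 <= k < d.+1)
    k%:R * s ^+ (k - 1) * tau ^+ (d + n.+1 - 1 - k) * (s - tau) ^+ 2 =
  tau ^+ n * ((s - tau) ^+ 2 *
    \sum_(i < d) i.+1%:R * s ^+ i * tau ^+ (d - i.+1)).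
  rewrite big_add1 /= big_mkord !mulr_sumr; apply: eq_bigr => i _.
  have -> : (d + n.+1 - 1 - i.+1 = n + (d - i.+1))%N by have := ltn_ord i; lia.
  by rewrite subn1 /= exprD; ring.
have -> : \sum_(0 <= j < n) (n - j)%:R * s ^+ (d + j) * tau ^+ (n.+1 - 2 - j) =
  s ^+ d * \sum_(i < n) i.+1%:R * tau ^+ i * s ^+ (n - i.+1).
  rewrite big_nat_rev /= big_mkord mulr_sumr; apply: eq_bigr => i _.
  have lt_in := ltn_ord i; rewrite add0n.
  have -> : (n - (n - i.+1) = i.+1)%N by lia.
  have -> : (n.+1 - 2 - (n - i.+1) = i)%N by lia.
  by rewrite exprD; ring.
have sqrBC : (s - tau) ^+ 2 = (tau - s) ^+ 2 by ring.
rewrite sum_tangent_gap sqrBC -[d%:R * (_ ^+ 2) * _]mulrA [(tau - s) ^+ 2 * _]mulrCA.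
rewrite sum_tangent_gap addnS !exprS !exprD -!natr1 natrD; ring.
Qed.
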